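(* Fix a constant $\delta>0$. Then for all sufficiently large $n>n_\delta$, $$\left(\mathrm{vol}(M_n)\right)^{1/\binom{n}{2}}\le \frac12+\frac{1}{n^{\frac16-\delta}}.$$
   Context: The metric polytope $M_n$ is the convex polytope in $\mathbb{R}^{\binom{n}{2}}$ (coordinates $d_{ij}$ indexed by pairs $\{i,j\}\subset[n]$) defined by the inequalities $0<d_{ij}\le 1$ for all pairs and $d_{ij}\le d_{ik}+d_{jk}$ for all distinct $i,j,k\in[n]$. $\mathrm{vol}$ denotes $\binom{n}{2}$-dimensional Lebesgue measure. *)

(* Defs.v *)
From HB Require Import structures.
From mathcomp Require Import all_boot all_order all_algebra.
From mathcomp Require Import all_classical all_reals all_analysis.
From mathcomp Require Import measurable_realfun.

Set Implicit Arguments.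
Unset Strict Implicit.
Unset Printing Implicit Defensive.

Import Order.TTheory GRing.Theory Num.Theory.

Local Open Scope classical_set_scope.
Local Open Scope ring_scope.

Section LebesgueTuple.
Context {R : realType}.
Local Notation RT := (measurableTypeR R).

Definition cons_pair {N : nat} (p : RT * N.-tuple RT) : N.+1.-tuple RT :=
  [tuple of p.1 :: p.2].

(* The N-dimensional Lebesgue measure, obtained by iterating the binary
   product of measures: R * R^m is identified with R^(m+1) by [cons_pair], and
   the one-point space R^0 has total mass 1. *)
Fixpoint lebesgue_tuple (N : nat) : set (N.-tuple RT) -> \bar R :=
  if N is m.+1
  then pushforward (lebesgue_measure \x @lebesgue_tuple m)%E (@cons_pair m)
  else \d_([tuple] : 0.-tuple RT).

Lemma measurable_cons_pair N : measurable_fun setT (@cons_pair N).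
Proof. exact: (@measurable_cons _ _ (RT * N.-tuple RT)%type RT fst N snd). Qed.

Section cons_measure.
Variables (N : nat) (m : {sigma_finite_measure set (N.-tuple RT) -> \bar R}).

Let mu := pushforward (@lebesgue_measure R \x m)%E (@cons_pair N).

Let mu0 : mu set0 = 0%E.
Proof. by rewrite /mu /pushforward preimage_set0 measure0. Qed.

Let mu_ge0 A : (0 <= mu A)%E.
Proof. by rewrite /mu /pushforward; apply: measure_ge0. Qed.

Let mu_sigma_additive : semi_sigma_additive mu.
Proof.
have mc := @measurable_cons_pair N.
move=> F mF tF mUF; rewrite /mu /pushforward preimage_bigcup.
apply: measure_semi_sigma_additive.
- by move=> i; rewrite -[X in measurable X]setTI; exact: mc.
- apply/trivIsetP => /= i j _ _ ij; rewrite -preimage_setI.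
  by move/trivIsetP : tF => /(_ _ _ _ _ ij) ->//; rewrite preimage_set0.
- by rewrite -preimage_bigcup -[X in measurable X]setTI; exact: mc.
Qed.

HB.instance Definition _ :=
  isMeasure.Build _ _ _ mu mu0 mu_ge0 mu_sigma_additive.

Let mu_sigma_finite : sigma_finite setT mu.
Proof.
have /sigma_finiteP[F [TF ndF Foo]] := sigma_finiteT (@lebesgue_measure R).
have /sigma_finiteP[G [TG ndG Goo]] := sigma_finiteT m.
pose f (t : N.+1.-tuple RT) : RT * N.-tuple RT :=
  (tnth t ord0, [tuple of behead t]).
have mf : measurable_fun setT f.
  apply: measurable_fun_pair; first exact: measurable_tnth.
  exact: measurable_behead.
have fK p : f (@cons_pair N p) = p.
  by case: p => x t; congr pair; apply: val_inj.
exists (fun k => f @^-1` (F k `*` G k)).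
  rewrite -preimage_bigcup [X in f @^-1` X](_ : _ = setT) ?preimage_setT//.
  rewrite -setXTT TF TG predeqE => -[x y]; split.
    by move=> [k _ []/= ? ?]; split; exists k.
  move=> [/= [k _ Fkx] [l _ Gly]]; exists (maxn k l) => //; split.
  - by move: x Fkx; exact/subsetPset/ndF/leq_maxl.
  - by move: y Gly; exact/subsetPset/ndG/leq_maxr.
move=> k; have [? ?] := Foo k; have [? ?] := Goo k; split.
  by rewrite -[X in measurable X]setTI; apply: mf => //; exact: measurableX.
rewrite /mu /pushforward -comp_preimage [_ \o _](_ : _ = id); last first.
  by apply/funext => p /=.
by rewrite preimage_id product_measure1E// lte_mul_pinfty// ge0_fin_numE.
Qed.

HB.instance Definition _ := Measure_isSigmaFinite.Build _ _ _ mu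
  mu_sigma_finite.

Definition cons_measure : {sigma_finite_measure set (N.+1.-tuple RT) -> \bar R}
  := mu.

End cons_measure.

Lemma lebesgue_tuple_sigma_finite_measure N :
  exists m : {sigma_finite_measure set (N.-tuple RT) -> \bar R},
    m = @lebesgue_tuple N :> (set (N.-tuple RT) -> \bar R).
Proof.
elim: N => [|N [m mE]]; first by exists (dirac ([tuple] : 0.-tuple RT)).
by exists (cons_measure m) => /=; rewrite -mE.
Qed.

Lemma measurable_tuple_box N (A : 'I_N -> set RT) :
  (forall i, measurable (A i)) ->
  measurable [set t : N.-tuple RT | forall i, A i (tnth t i)].
Proof.
move=> mA; rewrite [X in measurable X](_ : _ =
  \bigcap_(i in [set: 'I_N]) ((fun t : N.-tuple RT => tnth t i) @^-1` A i)).
  apply: fin_bigcap_measurable => // i _.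
  by rewrite -[X in measurable X]setTI; exact: measurable_tnth.
by apply/seteqP; split => t /= At i; move=> *; exact: At.
Qed.

Lemma lebesgue_tuple_box N (A : 'I_N -> set RT) :
  (forall i, measurable (A i)) ->
  lebesgue_tuple [set t : N.-tuple RT | forall i, A i (tnth t i)] =
  (\prod_(i < N) lebesgue_measure (A i))%E.
Proof.
elim: N => [|N IHN] in A *.
  by move=> _; rewrite big_ord0 /= diracE mem_set// => -[].
move=> mA; rewrite big_ord_recl -IHN// /=.
have [m mE] := lebesgue_tuple_sigma_finite_measure N.
rewrite -mE /pushforward.
rewrite [X in product_measure1 _ _ X](_ : _ =
  A ord0 `*` [set t : N.-tuple RT | forall i, A (lift ord0 i) (tnth t i)]).
  by rewrite product_measure1E//; exact: (@measurable_tuple_box N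
    (A \o lift ord0) (fun i => mA (lift ord0 i))).
apply/seteqP; split => -[x t] /=.
  move=> At; split; first exact: (At ord0).
  by move=> i; have := At (lift ord0 i); rewrite tnthS.
move=> [Ax At] i; case: (unliftP ord0 i) => [j ->|-> //].
by rewrite tnthS.
Qed.

End LebesgueTuple.

Section MetricPolytope.
Context {R : realType}.
Variable n : nat.

Definition upair := {e : {set 'I_n} | #|e| == 2%N}.

Lemma card_upair : #|{: upair}| = 'C(n, 2).
Proof.
rewrite card_sig; transitivity 'C(#|'I_n|, 2); last by rewrite card_ord.
by rewrite -card_draws; apply: eq_card => e; rewrite !inE.
Qed.

Local Notation point := (#|{: upair}|.-tuple (measurableTypeR R)).

(* The coordinate of [d] at the pair {i, j}; the diagonal gets the junk
   value 0. *)
Definition dist (d : point) (i j : 'I_n) : R :=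
  if (insub [set i; j]%SET : option upair) is Some e
  then tnth d (enum_rank e) else 0.

Definition metric_polytope : set point :=
  [set d | (forall i j, i != j -> 0 < dist d i j <= 1) /\
           (forall i j k, i != j -> i != k -> j != k ->
              dist d i j <= dist d i k + dist d j k)].

Lemma distE d (e : upair) i j :
  val e = [set i; j]%SET -> dist d i j = tnth d (enum_rank e).
Proof. by move=> eE; rewrite /dist -eE valK. Qed.

Lemma measurable_dist i j :
  measurable_fun setT (fun d => dist d i j).
Proof.
rewrite /dist; case: insubP => [e _ _|_]; first exact: measurable_tnth.
exact: measurable_cst.
Qed.

Lemma measurable_metric_polytope : measurable metric_polytope.
Proof.
have fin (A : set 'I_n) : finite_set A.
  exact: (sub_finite_set (@subsetT _ A)).
have mb (b : point -> bool) : measurable_fun setT b -> measurable [set d | b d].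
  by move=> mb; rewrite -[X in measurable X]setTI; exact: mb.
rewrite [X in measurable X](_ : _ =
    (\bigcap_(i in [set: 'I_n]) \bigcap_(j in [set j | i != j])
       ([set d | 0 < dist d i j] `&` [set d | dist d i j <= 1])) `&`
    (\bigcap_(i in [set: 'I_n]) \bigcap_(j in [set j | i != j])
       \bigcap_(k in [set k | (i != k) && (j != k)])
       [set d | dist d i j <= dist d i k + dist d j k])).
  apply: measurableI.
    do 2!(apply: fin_bigcap_measurable => [|? _]; first exact: fin).
    apply: measurableI; apply: mb.
      by apply: measurable_fun_ltr => //; exact: measurable_dist.
    by apply: measurable_fun_ler => //; exact: measurable_dist.
  do 3!(apply: fin_bigcap_measurable => [|? _]; first exact: fin).
  apply: mb; apply: measurable_fun_ler; first exact: measurable_dist.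
  by apply: measurable_funD; exact: measurable_dist.
apply/seteqP; split => d /=.
  move=> [d01 dT]; split.
    by move=> i _ j /= /d01/andP[].
  by move=> i _ j /= ij k /= /andP[]; exact: dT.
move=> [d01 dT]; split.
  by move=> i j ij; apply/andP; exact: (d01 i I j ij).
by move=> i j k ij ik jk; apply: (dT i I j ij k); rewrite /= ik jk.
Qed.

End MetricPolytope.
Arguments metric_polytope R n : clear implicits.

(* Main.v *)
Require Import Defs.
From mathcomp Require Import all_boot all_order all_algebra all_fingroup.
From mathcomp Require Import all_classical all_reals all_analysis.
From mathcomp Require Import ring lra zify.

(* Rounding distances up to multiples of [1/n] covers the polytope by cubes
   of side [1/n] indexed by integer metrics with values in [1, n], so it
   suffices to bound the entropy of a uniform random integer metric [x].  Let
   [h k] be the entropy of one distance [x_ab] given all the distances from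
   the first [k] vertices.  It decreases from at most [ln n] to at least [0],
   so for every [s] some [k < s] has [h k - h (k + 1) <= ln n / s], and then,
   by symmetry, the three sides of a triangle are almost independent given the
   distances from the first [k] vertices.  For independent sides, if [a, a'],
   [b, b'], [c, c'] are the [t]-quantile ranges, the triangle inequality forces
   [a' <= b + c], [b' <= a + c] and [c' <= a + b] (a violation would have
   probability at least [t^3]); adding these, the lengths of the three ranges
   sum to at most [3n/2] up to rounding, so [h k] is at most [ln (n/2)] up to a
   small error.  The chain rule bounds the total entropy by [h k] times the
   number of pairs, up to the [s n] pairs meeting the first [s] vertices.
   Taking [s] of order [n^(4/5)] and [t = n^(-1/5)], the error is
   [O(n^(-1/5) ln(n)^2)]. *)

Set Implicit Arguments.
Unset Strict Implicit.
Unset Printing Implicit Defensive.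

Import Order.TTheory GRing.Theory Num.Theory.

Local Open Scope ring_scope.
Local Open Scope set_scope.

(** * Elementary bounds on the logarithm *)

Lemma ln_leB1 (R : realType) (x : R) : 0 < x -> ln x <= x - 1.
Proof.
move=> x0; have := @le_ln1Dx R (x - 1).
by rewrite [1 + _]addrC subrK; apply; lra.
Qed.

(** AM-GM, obtained by adding three times the bound of [ln] by its tangent line at [c]. *)
Lemma ln_AMGM3 (R : realType) (x y z c : R) : 0 < x -> 0 < y -> 0 < z ->
  x + y + z <= 3 * c -> ln x + ln y + ln z <= 3 * ln c.
Proof.
move=> x0 y0 z0 le3.
have c0 : 0 < c by lra.
have tangent u : 0 < u -> ln u <= ln c + u / c - 1.
  move=> u0; have := ln_leB1 (divr_gt0 u0 c0).
  rewrite ln_div ?posrE//; lra.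
have := tangent _ x0; have := tangent _ y0; have := tangent _ z0.
have : x / c + y / c + z / c <= 3.
  by rewrite -!mulrDl ler_pdivrMr.
lra.
Qed.

(** * Entropy of functions on a finite set *)

Section Entropy.
Variables (R : realType) (T : finType).
Implicit Types G : {set T}.

(** Divided by [#|G|], this is the probability of the value [X w]. *)
Definition cnt (V : eqType) G (X : T -> V) (w : T) : nat :=
  #|[set u in G | X u == X w]|.

(* [#|G|] times the Shannon entropy of [X] for the uniform distribution
   on [G]. *)
Definition ent (V : eqType) G (X : T -> V) : R :=
  \sum_(w in G) (ln #|G|%:R - ln (cnt G X w)%:R).

Lemma cnt_gt0 (V : eqType) G (X : T -> V) w : w \in G -> (0 < cnt G X w)%N.
Proof. by move=> wG; apply/card_gt0P; exists w; rewrite inE wG eqxx. Qed.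

Lemma cntP (V : eqType) G (X : T -> V) w :
  w \in G -> 0 < (cnt G X w)%:R :> R.
Proof. by move=> wG; rewrite ltr0n cnt_gt0. Qed.

Lemma cardP G w : w \in G -> 0 < #|G|%:R :> R.
Proof. by move=> wG; rewrite ltr0n; apply/card_gt0P; exists w. Qed.

Lemma ent_ge0 (V : eqType) G (X : T -> V) : 0 <= ent G X.
Proof.
apply: sumr_ge0 => w wG.
rewrite subr_ge0 ler_ln ?posrE ?(cntP _ wG) ?(cardP wG)// ler_nat.
by apply: subset_leq_card; apply/fintype.subsetP => u; rewrite inE => /andP[].
Qed.

(** The [cnt G X u] points of a fibre share the weight of its value equally. *)
Lemma sum_div_cnt (V : finType) G (X : T -> V) (w : V -> R) :
  \sum_(u in G) w (X u) / (cnt G X u)%:R = \sum_(v in X @: G) w v.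
Proof.
rewrite (partition_big_imset X); apply: eq_bigr => v /imsetP[u0 u0G ->].
rewrite (eq_bigr (fun=> w (X u0) / (cnt G X u0)%:R)); last first.
  by move=> u /andP[uG /eqP Xu]; rewrite /cnt Xu.
rewrite sumr_const [X in _ *+ X](_ : _ = cnt G X u0); last first.
  by apply: eq_card => u; rewrite inE.
by rewrite -[LHS]mulr_natr divfK// gt_eqF// cntP.
Qed.

(* Summing [ln x <= x - 1] is Gibbs' inequality, with the mass missed by the
   range of [X] kept as an extra gain. *)
Lemma gibbs (V : finType) G (X : T -> V) (w : V -> R) (W : R) : 0 < W ->
  {in G, forall u, 0 < w (X u)} ->
  ent G X + \sum_(u in G) (ln (w (X u)) - ln W) <=
  #|G|%:R * ((\sum_(v in X @: G) w v) / W - 1).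
Proof.
move=> W0 w0; rewrite -big_split/= -sum_div_cnt mulrBr mulr1.
have -> : #|G|%:R * ((\sum_(u in G) w (X u) / (cnt G X u)%:R) / W) - #|G|%:R =
    \sum_(u in G) (#|G|%:R * (w (X u) / (cnt G X u)%:R) / W - 1).
  by rewrite sumrB sumr_const -mulr_suml -mulr_sumr mulrA.
apply: ler_sum => u uG.
have c0 := cntP X uG; have g0 := cardP uG; have wu := w0 _ uG.
have gw : 0 < #|G|%:R * (w (X u) / (cnt G X u)%:R) / W :> R.
  by rewrite divr_gt0// mulr_gt0// divr_gt0.
have wc0 := divr_gt0 wu c0; have gwc0 := mulr_gt0 g0 wc0.
have := ln_leB1 gw.
rewrite (ln_div gwc0 W0) (lnM g0 wc0) (ln_div wu c0); lra.
Qed.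

(** Gibbs with weight 1 on every value and total [#|V|]. *)
Lemma ent_le (V : finType) G (X : T -> V) : (0 < #|V|)%N ->
  ent G X <= #|G|%:R * ln #|V|%:R.
Proof.
move=> V0; have V0' : 0 < #|V|%:R :> R by rewrite ltr0n.
have := @gibbs V G X (fun=> 1) _ V0' (fun _ _ => ltr01).
rewrite ln1 sub0r !sumr_const -[- ln _ *+ _]mulr_natl mulrN lerBlDr.
move=> /le_trans; apply; rewrite gerDr mulr_ge0_le0//.
by rewrite subr_le0 ler_pdivrMr// mul1r ler_nat max_card.
Qed.

Lemma sum_fiber (V : finType) G (X : T -> V) (P : pred V) :
  \sum_(v | P v) #|[set u in G | X u == v]|%:R =
  #|[set u in G | P (X u)]|%:R :> R.
Proof.
rewrite -natr_sum; congr _%:R; rewrite -sum1_card.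
rewrite (partition_big X P)/= => [|u]; last by rewrite inE => /andP[].
apply: eq_bigr => v Pv; rewrite -sum1_card; apply: eq_bigl => u.
by rewrite !inE; case: eqP => [->|]; rewrite ?Pv ?andbT ?andbF.
Qed.

(* The triple [(X, Y, Z)] misses the box [P * Q * S], so the mass of that box
   under the product of the marginals bounds the mutual information of
   [X], [Y], [Z] from below. *)
Lemma ent_triple (V : finType) G (X Y Z : T -> V) (P Q S : pred V) :
  (forall u, u \in G -> ~~ [&& P (X u), Q (Y u) & S (Z u)]) ->
  #|[set u in G | P (X u)]|%:R * #|[set u in G | Q (Y u)]|%:R *
    #|[set u in G | S (Z u)]|%:R <=
  #|G|%:R ^+ 2 * (ent G X + ent G Y + ent G Z
    - ent G (fun u => (X u, Y u, Z u))) :> R.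
Proof.
move=> noPQS.
have [->|/finset.set0Pn[u0 u0G]] := eqVneq G finset.set0.
  rewrite (_ : [set u in finset.set0 | P (X u)] = finset.set0).
    by rewrite cards0 expr0n !mul0r.
  by apply/setP => u; rewrite !inE.
have g0 := cardP u0G.
pose f (X : T -> V) v : R := #|[set u in G | X u == v]|%:R.
pose w (v : V * V * V) := f X v.1.1 * f Y v.1.2 * f Z v.2.
have f0 (X' : T -> V) v : 0 <= f X' v by rewrite ler0n.
have w0 v : 0 <= w v by rewrite !mulr_ge0.
pose XYZ u := (X u, Y u, Z u).
have wE u : u \in G ->
    w (XYZ u) = (cnt G X u)%:R * (cnt G Y u)%:R * (cnt G Z u)%:R by [].
have wXYZ0 : {in G, forall u, 0 < w (XYZ u)}.
  by move=> u uG; rewrite wE// !mulr_gt0// cntP.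
(* The weights are the unnormalised product of the marginals, of total mass [#|G|^3]. *)
have := gibbs (exprn_gt0 3 g0) wXYZ0.
have -> : \sum_(u in G) (ln (w (XYZ u)) - ln (#|G|%:R ^+ 3)) =
    - (ent G X + ent G Y + ent G Z).
  rewrite -!big_split -sumrN; apply: eq_bigr => u uG /=.
  rewrite wE// lnXn// !lnM ?posrE ?mulr_gt0 ?cntP//; lra.
have sumw (A B C : pred V) :
  \sum_(v | [&& A v.1.1, B v.1.2 & C v.2]) w v =
  #|[set u in G | A (X u)]|%:R * #|[set u in G | B (Y u)]|%:R *
    #|[set u in G | C (Z u)]|%:R.
  rewrite -!(sum_fiber G _ _) big_distrlr/= pair_big/= big_distrlr/= pair_big/=.
  by apply: eq_bigl => v; rewrite andbA.
have sumT : \sum_v w v = #|G|%:R ^+ 3.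
  have GT (X' : T -> V) : [set u in G | predT (X' u)] = G.
    by apply/setP => u; rewrite inE andbT.
  have := sumw predT predT predT; rewrite !GT => /= ->.
  by rewrite !exprS expr0; ring.
pose PQS (v : V * V * V) := [&& P v.1.1, Q v.1.2 & S v.2].
pose K := \sum_(v | PQS v) w v.
(* The range of the triple avoids the box, so its weight falls short of the total by at least the
   weight [K] of the box. *)
have leK : \sum_(v in XYZ @: G) w v <= #|G|%:R ^+ 3 - K.
  rewrite -sumT lerBrDr /K [leRHS](bigID PQS predT)/=.
  rewrite [leLHS]addrC lerD2l.
  rewrite [leLHS]big_mkcond [leRHS]big_mkcond/=; apply: ler_sum => v _.
  case: imsetP => [[u uG ->]|_]; last by case: ifP.
  by rewrite /PQS /= noPQS.
rewrite -sumw -/K => le1.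
have : ent G XYZ - (ent G X + ent G Y + ent G Z) <= - (K / #|G|%:R ^+ 2).
  apply: (le_trans le1); rewrite -subr_ge0.
  rewrite (_ : _ - _ =
      (#|G|%:R ^+ 3 - K - \sum_(v in XYZ @: G) w v) / #|G|%:R ^+ 2).
    by apply: divr_ge0; [rewrite subr_ge0|rewrite exprn_ge0// ltW].
  by field; rewrite gt_eqF.
rewrite -/XYZ => le2.
rewrite -ler_pdivrMl ?exprn_gt0// mulrC; lra.
Qed.


Lemma eq_ent (V V' : eqType) G (X : T -> V) (Y : T -> V') :
  {in G &, forall u w, (X u == X w) = (Y u == Y w)} -> ent G X = ent G Y.
Proof.
move=> eqXY; apply: eq_bigr => w wG; congr (_ - ln _%:R); apply: eq_card => u.
by rewrite !inE; case uG: (u \in G) => //=; rewrite eqXY.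
Qed.

Lemma ent_const (V : eqType) G (X : T -> V) :
  {in G &, forall u w, X u = X w} -> ent G X = 0.
Proof.
move=> Xcst; rewrite /ent big1// => w wG; apply/eqP; rewrite subr_eq0.
apply/eqP; congr (ln _%:R); apply: eq_card => u; rewrite inE.
by case uG: (u \in G) => //=; rewrite (Xcst _ _ uG wG) eqxx.
Qed.

(** Mutual information is nonnegative: [ent_triple] with an empty box and a constant third
    variable. *)
Lemma ent_subadd (V : finType) G (X Y : T -> V) :
  ent G (fun u => (X u, Y u)) <= ent G X + ent G Y.
Proof.
have [->|/finset.set0Pn[u0 u0G]] := eqVneq G finset.set0.
  by rewrite /ent !big_set0 addr0.
have := @ent_triple V G X Y (fun=> X u0) pred0 pred0 pred0 (fun _ _ => isT).
rewrite [ent G (fun=> X u0)]ent_const// addr0.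
rewrite (@eq_ent _ _ G (fun u => (X u, Y u, X u0)) (fun u => (X u, Y u))).
  have -> : [set u in G | pred0 (X u)] = finset.set0 :> {set T}.
    by apply/setP => u; rewrite !inE andbF.
  by rewrite cards0 !mul0r pmulr_rge0 ?exprn_gt0 ?(cardP u0G)// subr_ge0.
by move=> u w _ _; rewrite /= !xpair_eqE eqxx andbT.
Qed.

(** * Quantile ranges and the entropy of a triangle *)

Lemma lower_quantile G (X : T -> nat) (m : nat) (t : R) : 0 <= t <= 1 ->
  (forall u, (X u < m)%N) ->
  exists a, t * #|G|%:R <= #|[set u in G | (X u <= a)%N]|%:R /\
            #|[set u in G | (X u < a)%N]|%:R <= t * #|G|%:R.
Proof.
move=> /andP[t0 t1] Xm.
pose P a := t * #|G|%:R <= #|[set u in G | (X u <= a)%N]|%:R.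
have exP : exists a, P a.
  exists m; rewrite /P (_ : [set u in G | _] = G) ?ler_piMl//.
  by apply/setP => u; rewrite inE ltnW ?andbT.
(* The second bound is minimality of [a]: the event [X < a] is [X <= a - 1], or is empty when
   [a = 0]. *)
exists (ex_minn exP); case: ex_minnP => a Pa amin; split => //.
case: a => [|a] in Pa amin *.
  rewrite (_ : [set u in G | _] = finset.set0) ?cards0 ?mulr_ge0//.
  by apply/setP => u; rewrite !inE ltn0 andbF.
rewrite leNgt; apply/negP => lta.
suff : (a < a)%N by rewrite ltnn.
apply: amin; exact: ltW.
Qed.

(** The lower quantile of the reflected variable [m.-1 - X]. *)
Lemma upper_quantile G (X : T -> nat) (m : nat) (t : R) : 0 <= t <= 1 ->
  (forall u, (X u < m)%N) -> (0 < m)%N ->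
  exists b, [/\ (b < m)%N,
    t * #|G|%:R <= #|[set u in G | (b <= X u)%N]|%:R &
    #|[set u in G | (b < X u)%N]|%:R <= t * #|G|%:R].
Proof.
move=> t01 Xm m0.
have [|a [ge_t le_t]] := @lower_quantile G (fun u => m.-1 - X u)%N m t t01.
  by move=> u; lia.
have sub (P Q : pred T) : (forall u, P u -> Q u) ->
    #|[set u in G | P u]|%:R <= #|[set u in G | Q u]|%:R :> R.
  move=> PQ; rewrite ler_nat; apply/subset_leq_card/fintype.subsetP => u.
  by rewrite !inE => /andP[-> /PQ].
exists (m.-1 - a)%N; split.
- by lia.
- by apply: le_trans ge_t _; apply: sub => u; have := Xm u; lia.
- by apply: le_trans le_t; apply: sub => u; have := Xm u; lia.
Qed.

Lemma card_ord_itv (m a b : nat) :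
  (#|[pred v : 'I_m | (a <= v <= b)%N]| <= b.+1 - a)%N.
Proof.
rewrite cardE -(size_map val) -(size_iota a (b.+1 - a)); apply: uniq_leq_size.
  by rewrite map_inj_uniq ?enum_uniq//; exact: val_inj.
move=> _ /mapP[v + ->]; rewrite mem_enum inE mem_iota /= => /andP[]; lia.
Qed.

(** Gibbs with weight 1 on the quantile range [[a, b]] and [t] outside: the total weight is at most
    [b + 1 - a + t m], and the tails, at most [2 t #|G|] points, cost [- ln t] each. *)
Lemma ent_le_itv G (m : nat) (X : T -> 'I_m) (t : R) : 0 < t < 1 / 2 ->
  (0 < #|G|)%N ->
  exists a b, [/\ (b < m)%N, (a <= b.+1)%N,
    t * #|G|%:R <= #|[set u in G | (X u <= a)%N]|%:R,
    t * #|G|%:R <= #|[set u in G | (b <= X u)%N]|%:R &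
    ent G X <= #|G|%:R * (ln (b.+1%:R - a%:R + t * m%:R) - 2 * t * ln t)].
Proof.
move=> /andP[t0 t2] G0; have t01 : 0 <= t <= 1 by apply/andP; lra.
have g0 : 0 < #|G|%:R :> R by rewrite ltr0n.
have /card_gt0P[u0 u0G] := G0.
have m0 : (0 < m)%N by apply: leq_ltn_trans (ltn_ord (X u0)).
have m0R : 0 < m%:R :> R by rewrite ltr0n.
have [a [lea gea]] := @lower_quantile G X m t t01 (fun u => ltn_ord (X u)).
have [b [bm leb geb]] :=
  @upper_quantile G X m t t01 (fun u => ltn_ord (X u)) m0.
have tail : #|[set u in G | ~~ (a <= X u <= b)%N]|%:R <= 2 * t * #|G|%:R.
  have : #|[set u in G | ~~ (a <= X u <= b)%N]|%:R <=
      #|[set u in G | (X u < a)%N]|%:R + #|[set u in G | (b < X u)%N]|%:R :> R.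
    rewrite -natrD ler_nat; apply: leq_trans (leq_card_setU _ _).
    apply/subset_leq_card/fintype.subsetP => u; rewrite !inE negb_and -!ltnNge.
    by case: (u \in G).
  lra.
(* With [b.+1 < a] the tails would contain all of [G], against [2 t < 1]. *)
have ab : (a <= b.+1)%N.
  rewrite leqNgt; apply/negP => ba.
  suff : #|G|%:R <= 2 * t * #|G|%:R by rewrite ler_pMl//; lra.
  apply: le_trans tail; rewrite ler_nat.
  apply/subset_leq_card/fintype.subsetP => u.
  by rewrite inE => ->/=; clear -ba; lia.
exists a, b; split => //.
pose w (v : 'I_m) : R := if (a <= v <= b)%N then 1 else t.
pose W : R := b.+1%:R - a%:R + t * m%:R.
have W0 : 0 < W.
  rewrite ltr_wpDl ?mulr_gt0// subr_ge0 ler_nat//.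
have w0 : {in G, forall u, 0 < w (X u)} by move=> u _; rewrite /w; case: ifP.
have := gibbs W0 w0.
have sumw : \sum_(v in X @: G) w v <= W.
  apply: (@le_trans _ _ (\sum_v w v)).
    rewrite [leRHS](bigID [in X @: G])/= lerDl sumr_ge0// => v _.
    by rewrite /w; case: ifP => // _; exact: ltW.
  have -> : \sum_v w v = \sum_(v < m | (a <= v <= b)%N) 1 +
      \sum_(v < m | ~~ (a <= v <= b)%N) t.
    rewrite (bigID [pred v : 'I_m | (a <= v <= b)%N])/=; congr (_ + _).
      by apply: eq_bigr => v; rewrite /w => ->.
    by apply: eq_bigr => v; rewrite /w => /negbTE ->.
  rewrite !sumr_const; apply: lerD.
    by rewrite -natrB// ler_nat card_ord_itv.
  rewrite -[t *+ _]mulr_natr ler_pM2l// ler_nat.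
  by apply: leq_trans (max_card _) _; rewrite card_ord.
have : #|G|%:R * ((\sum_(v in X @: G) w v) / W - 1) <= 0.
  by rewrite pmulr_rle0// subr_le0 ler_pdivrMr// mul1r.
rewrite sumrB sumr_const -[_ *+ #|G|]mulr_natl.
have -> : \sum_(u in G) ln (w (X u)) =
    #|[set u in G | ~~ (a <= X u <= b)%N]|%:R * ln t.
  rewrite (bigID (fun u => (a <= X u <= b)%N))/= big1 ?add0r; last first.
    by move=> u /andP[_ Xu]; rewrite /w Xu ln1.
  rewrite (eq_bigr (fun=> ln t)); last first.
    by move=> u /andP[_ /negbTE Xu]; rewrite /w Xu.
  rewrite sumr_const -[_ *+ _]mulr_natl; congr (_%:R * _).
  by apply: eq_card => u; rewrite inE.
have lnt : ln t <= 0 by apply: ln_le0; lra.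
have := ler_wnM2r lnt tail; rewrite -/W; lra.
Qed.

(** If three tails, each of share at least [t], are incompatible with a triangle inequality,
    [ent_triple] makes the information deficit at least [t^3 #|G|], and the last summand alone
    exceeds the trivial bound [3 #|G| ln m]. Otherwise the quantile ranges are short and AM-GM
    applies to their lengths. *)
Lemma ent_metric_triple G (m : nat) (X Y Z : T -> 'I_m) (t : R) :
  0 < t < 1 / 2 -> (0 < #|G|)%N ->
  (forall u, u \in G -> [/\ (X u <= Y u + Z u + 1)%N,
     (Y u <= X u + Z u + 1)%N & (Z u <= X u + Y u + 1)%N]) ->
  ent G X + ent G Y + ent G Z <=
  3 * #|G|%:R * (ln (m%:R / 2 + 1 + t * m%:R) - 2 * t * ln t) +
  3 * ln m%:R / t ^+ 3 *
    (ent G X + ent G Y + ent G Z - ent G (fun u => (X u, Y u, Z u))).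
Proof.
move=> t12 G0 triG; have /andP[t0 t2] := t12.
have g0 : 0 < #|G|%:R :> R by rewrite ltr0n.
have /card_gt0P[u0 u0G] := G0.
have m0 : (0 < m)%N by apply: leq_ltn_trans (ltn_ord (X u0)).
have m0R : 1 <= m%:R :> R by rewrite ler1n.
have lnm : 0 <= ln m%:R :> R by rewrite ln_ge0.
have lnt : ln t <= 0 by apply: ln_le0; lra.
have tm : 0 < t * m%:R by rewrite mulr_gt0//; lra.
set D := _ - ent G (fun u => _).
have main0 : 0 <= ln (m%:R / 2 + 1 + t * m%:R) - 2 * t * ln t.
  have : 0 <= ln (m%:R / 2 + 1 + t * m%:R) by rewrite ln_ge0//; lra.
  have := mulr_ge0_le0 (ltW t0) lnt; lra.
have violated (P Q S : pred 'I_m) :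
    t * #|G|%:R <= #|[set u in G | P (X u)]|%:R ->
    t * #|G|%:R <= #|[set u in G | Q (Y u)]|%:R ->
    t * #|G|%:R <= #|[set u in G | S (Z u)]|%:R ->
    (forall u, u \in G -> ~~ [&& P (X u), Q (Y u) & S (Z u)]) ->
    ent G X + ent G Y + ent G Z <=
      3 * #|G|%:R * (ln (m%:R / 2 + 1 + t * m%:R) - 2 * t * ln t) +
      3 * ln m%:R / t ^+ 3 * D.
  move=> tP tQ tS /ent_triple le1.
  have tg0 : 0 <= t * #|G|%:R by rewrite mulr_ge0// ltW.
  have : (t * #|G|%:R) ^+ 3 <= #|G|%:R ^+ 2 * D.
    by apply: le_trans le1; rewrite !exprS expr0 mulr1 mulrA !ler_pM// mulr_ge0.
  have -> : (t * #|G|%:R) ^+ 3 = #|G|%:R ^+ 2 * (t ^+ 3 * #|G|%:R) by ring.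
  rewrite ler_pM2l ?exprn_gt0// => tD.
  have gD : #|G|%:R <= D / t ^+ 3 by rewrite ler_pdivlMr ?exprn_gt0// mulrC.
  have Im : (0 < #|'I_m|)%N by rewrite card_ord.
  have := ent_le G X Im; have := ent_le G Y Im; have := ent_le G Z Im.
  rewrite card_ord.
  have := ler_wpM2l lnm gD.
  have := mulr_ge0 (ltW g0) main0.
  have -> : 3 * ln m%:R / t ^+ 3 * D = 3 * (ln m%:R * (D / t ^+ 3)) by ring.
  lra.
have [aX [bX [bXm abX leaX lebX entX]]] := ent_le_itv X t12 G0.
have [aY [bY [bYm abY leaY lebY entY]]] := ent_le_itv Y t12 G0.
have [aZ [bZ [bZm abZ leaZ lebZ entZ]]] := ent_le_itv Z t12 G0.
have [vX|vX] := ltnP (aY + aZ + 1) bX.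
  apply: (violated (fun v => bX <= v)%N (fun v => v <= aY)%N
    (fun v => v <= aZ)%N lebX leaY leaZ) => u /triG[].
  by clear -vX; lia.
have [vY|vY] := ltnP (aX + aZ + 1) bY.
  apply: (violated (fun v => v <= aX)%N (fun v => bY <= v)%N
    (fun v => v <= aZ)%N leaX lebY leaZ) => u /triG[].
  by clear -vY; lia.
have [vZ|vZ] := ltnP (aX + aY + 1) bZ.
  apply: (violated (fun v => v <= aX)%N (fun v => v <= aY)%N
    (fun v => bZ <= v)%N leaX leaY lebZ) => u /triG[].
  by clear -vZ; lia.
have D0 : 0 <= D.
  have := @ent_triple _ G X Y Z pred0 pred0 pred0 (fun _ _ => isT).
  rewrite (_ : [set u in G | pred0 (X u)] = finset.set0); last first.
    by apply/setP => u; rewrite !inE andbF.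
  by rewrite cards0 !mul0r pmulr_rge0 ?exprn_gt0.
have : 0 <= 3 * ln m%:R / t ^+ 3 * D.
  by rewrite mulr_ge0// divr_ge0 ?exprn_ge0 ?(ltW t0)// mulr_ge0.
suff : ln (bX.+1%:R - aX%:R + t * m%:R) + ln (bY.+1%:R - aY%:R + t * m%:R) +
    ln (bZ.+1%:R - aZ%:R + t * m%:R) <= 3 * ln (m%:R / 2 + 1 + t * m%:R) :> R.
  move=> /(ler_wpM2l (ltW g0)); lra.
have pos (a b : nat) : (a <= b.+1)%N -> 0 < b.+1%:R - a%:R + t * m%:R :> R.
  by move=> ab; rewrite ltr_wpDl// subr_ge0 ler_nat.
apply: ln_AMGM3; rewrite ?pos//.
(* Each [b] is at most 1 plus the other two [a], and is less than [m]; adding these six bounds gives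
   the average length [m / 2 + 1]. *)
have : (2 * (bX.+1 + bY.+1 + bZ.+1) <= 2 * (aX + aY + aZ) + 3 * m + 6)%N.
  by clear -vX vY vZ bXm bYm bZm; lia.
rewrite -(ler_nat R) !(natrD, natrM); lra.
Qed.


(** * Chain rule and invariance *)

Lemma ent_chain (V : finType) (V' : eqType) G (Y : T -> V) (X : T -> V') :
  ent G (fun u => (Y u, X u)) - ent G Y =
  \sum_v ent [set u in G | Y u == v] X.
Proof.
rewrite -sumrB (partition_big Y predT)//=; apply: eq_bigr => v _.
rewrite [RHS]/ent; apply: eq_big => [u|u /andP[uG /eqP Yu]].
  by rewrite inE.
rewrite opprB addrC addrA subrK; congr (ln _%:R - ln _%:R); apply: eq_card => w.
  by rewrite !inE Yu.
by rewrite !inE xpair_eqE Yu andbA.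
Qed.

Lemma ent_reindex (V : eqType) G (X : T -> V) (phi : T -> T) :
  injective phi -> (forall u, (phi u \in G) = (u \in G)) ->
  ent G (fun u => X (phi u)) = ent G X.
Proof.
move=> phiI phiG; rewrite /ent [RHS](reindex_inj phiI)/=.
apply: eq_big => [u|u uG]; first by rewrite phiG.
congr (_ - ln _%:R); rewrite /cnt -[in RHS](card_preimset _ phiI).
by apply: eq_card => w; rewrite !inE phiG.
Qed.

End Entropy.

(** * Entropy of sets of coordinates *)

Section Projections.
Variables (R : realType) (E : finType) (V : finType).
Variable M : {set {ffun E -> V}}.
Implicit Types (A B F : {set E}) (x y : {ffun E -> V}).

(** [None] outside [A] puts the restrictions to all sets of coordinates in one finite type. *)
Definition restr A (x : {ffun E -> V}) : {ffun E -> option V} :=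
  [ffun e => if e \in A then Some (x e) else None].

Definition entp A : R := ent R M (restr A).

Lemma restrP A x y :
  reflect {in A, forall e, x e = y e} (restr A x == restr A y).
Proof.
apply: (iffP eqP) => [xy e eA|xy].
  by move/ffunP/(_ e): xy; rewrite !ffunE eA => -[].
by apply/ffunP => e; rewrite !ffunE; case: ifP => // /xy ->.
Qed.

Lemma restrU A B x y :
  (restr (A :|: B) x == restr (A :|: B) y) =
  (restr A x == restr A y) && (restr B x == restr B y).
Proof.
apply/restrP/andP => [xy|[/restrP xyA /restrP xyB] e].
  by split; apply/restrP => e eA; apply: xy; rewrite inE eA ?orbT.
by rewrite inE => /orP[/xyA|/xyB].
Qed.

Lemma restr1 e x y : (restr [set e] x == restr [set e] y) = (x e == y e).
Proof.
by apply/restrP/eqP => [|xy f]; [apply; rewrite inE | rewrite inE => /eqP ->].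
Qed.

Lemma entp_chain F A : entp (F :|: A) - entp F =
  \sum_f ent R [set x in M | restr F x == f] (restr A).
Proof.
rewrite -ent_chain; congr (_ - _); apply: eq_ent => x y _ _.
by rewrite xpair_eqE restrU.
Qed.

Lemma entp_chain1 F e : entp (e |: F) - entp F =
  \sum_f ent R [set x in M | restr F x == f] (fun x => x e).
Proof.
rewrite finset.setUC entp_chain; apply: eq_bigr => f _.
by apply: eq_ent => x y _ _; rewrite restr1.
Qed.

Lemma card_fibers F :
  #|M|%:R = \sum_f #|[set x in M | restr F x == f]|%:R :> R.
Proof.
rewrite (sum_fiber R M (restr F) predT); congr _%:R.
by apply: eq_card => x; rewrite inE andbT.
Qed.

Lemma entp_subset A B : A \subset B -> entp A <= entp B.
Proof.
move=> /finset.setUidPr <-; rewrite -subr_ge0 entp_chain sumr_ge0// => f _.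
exact: ent_ge0.
Qed.

(** Subadditivity on each fibre of the restriction to [F], summed by the chain rule. *)
Lemma entp_submod F A B :
  entp (F :|: (A :|: B)) + entp F <= entp (F :|: A) + entp (F :|: B).
Proof.
suff : entp (F :|: (A :|: B)) - entp F <=
    (entp (F :|: A) - entp F) + (entp (F :|: B) - entp F) by lra.
rewrite !entp_chain -big_split/=; apply: ler_sum => f _.
apply: le_trans (ent_subadd _ _ _ _).
by rewrite (@eq_ent _ _ _ _ _ _ (fun x => (restr A x, restr B x)))// => x y _ _;
  rewrite xpair_eqE restrU.
Qed.

Lemma entp1_le F e : (0 < #|V|)%N ->
  entp (e |: F) - entp F <= #|M|%:R * ln #|V|%:R.
Proof.
move=> V0; rewrite entp_chain1 (card_fibers F) mulr_suml; apply: ler_sum => f _.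
exact: ent_le.
Qed.

Lemma entp0 : entp finset.set0 = 0.
Proof. by apply: ent_const => x y _ _; apply/eqP/restrP => e; rewrite inE. Qed.

Lemma entp_inj A : {in M &, injective (restr A)} ->
  entp A = #|M|%:R * ln #|M|%:R.
Proof.
move=> inj; rewrite /entp /ent (eq_bigr (fun=> ln #|M|%:R)) => [|x xM].
  by rewrite sumr_const -[LHS]mulr_natl.
rewrite /cnt (_ : [set u in M | _] = [set x]) ?cards1 ?ln1 ?subr0//.
apply/setP => y; rewrite !inE; apply/andP/eqP => [[yM /eqP]|->//].
exact: inj.
Qed.

(** Coordinates are added one at a time; by submodularity, those already added can only lower the
    entropy of the next. *)
Lemma entp_sum F A :
  entp (F :|: A) - entp F <= \sum_(e in A) (entp (e |: F) - entp F).
Proof.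
suff seqP (s : seq E) : entp (F :|: [set x in s]) - entp F <=
    \sum_(e <- s) (entp (e |: F) - entp F).
  by have := seqP (enum A); rewrite set_enum big_enum.
elim: s => [|e s IHs].
  by rewrite big_nil [X in F :|: X](_ : _ = finset.set0) ?finset.setU0 ?subrr.
rewrite big_cons.
have -> : [set x in e :: s] = [set e] :|: [set x in s].
  by apply/setP => x; rewrite !inE.
have := entp_submod F [set e] [set x in s].
rewrite [F :|: [set e]]finset.setUC; lra.
Qed.

Lemma entp_imset A (p : E -> E) : bijective p ->
  (forall x : {ffun E -> V}, ([ffun e => x (p e)] \in M) = (x \in M)) ->
  entp (p @: A) = entp A.
Proof.
move=> [q pK qK] pM; pose phi (x : {ffun E -> V}) := [ffun e => x (p e)].
have phiI : injective phi.
  move=> x y /ffunP xy; apply/ffunP => e.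
  by have := xy (q e); rewrite !ffunE qK.
rewrite /entp -(ent_reindex _ (restr A) phiI pM); apply: eq_ent => x y _ _.
apply/restrP/restrP => xy e.
  by move=> eA; rewrite !ffunE; apply: xy; apply/imsetP; exists e.
by move=> /imsetP[e' /xy + ->]; rewrite !ffunE.
Qed.

End Projections.

(** The bound of [ent_metric_triple] is linear in the entropies and in the size of the set, so it
    sums over the fibres of the restriction to [F]. *)
Lemma entp_metric_triple (R : realType) (E : finType) (m : nat)
    (M : {set {ffun E -> 'I_m}}) (F : {set E}) (e1 e2 e3 : E) (t : R) :
  0 < t < 1 / 2 ->
  (forall x, x \in M -> [/\ (x e1 <= x e2 + x e3 + 1)%N,
     (x e2 <= x e1 + x e3 + 1)%N & (x e3 <= x e1 + x e2 + 1)%N]) ->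
  forall H : E -> R, H = (fun e => entp R M (e |: F) - entp R M F) ->
  H e1 + H e2 + H e3 <=
  3 * #|M|%:R * (ln (m%:R / 2 + 1 + t * m%:R) - 2 * t * ln t) +
  3 * ln m%:R / t ^+ 3 * (H e1 + H e2 + H e3 -
    (entp R M (F :|: [set e1; e2; e3]) - entp R M F)).
Proof.
move=> t12 triM H HE.
have -> : entp R M (F :|: [set e1; e2; e3]) - entp R M F =
    \sum_f ent R [set x in M | restr F x == f] (fun x => (x e1, x e2, x e3)).
  rewrite entp_chain; apply: eq_bigr => f _; apply: eq_ent => x y _ _.
  by rewrite !restrU !restr1 !xpair_eqE.
rewrite HE !entp_chain1 (card_fibers R M F) mulr_sumr mulr_suml.
rewrite -!big_split -sumrB mulr_sumr -big_split/=; apply: ler_sum => f _.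
have [->|fib0] := eqVneq [set x in M | restr F x == f] finset.set0.
  by rewrite /ent !big_set0 cards0 !(addr0, subr0, mulr0, mul0r).
apply: ent_metric_triple => //; first by rewrite card_gt0.
by move=> x; rewrite inE => /andP[/triM].
Qed.

(** * Integer metrics and their symmetries *)

Section IntegerMetrics.
Variables (R : realType) (n m : nat).
Local Notation E := {set 'I_n}.
Implicit Types (x : {ffun E -> 'I_m}) (i j k : 'I_n) (e : E).

(* Distances are [x e + 1], so that they range over [1, m]; coordinates off
   the 2-element sets are pinned to [0]. *)
Definition int_metrics : {set {ffun E -> 'I_m}} :=
  [set x : {ffun E -> 'I_m} |
    [forall e : E, (#|e| != 2%N) ==> (x e == 0 :> nat)] &&
    [forall i : 'I_n, forall j : 'I_n, forall k : 'I_n,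
       [&& i != j, i != k & j != k] ==>
       (x [set i; j] <= x [set i; k] + x [set j; k] + 1)%N]].

Lemma int_metricsP x :
  reflect ((forall e, #|e| != 2%N -> x e = 0 :> nat) /\
    (forall i j k, i != j -> i != k -> j != k ->
      (x [set i; j] <= x [set i; k] + x [set j; k] + 1)%N))
  (x \in int_metrics).
Proof.
rewrite inE; apply: (iffP andP) => -[x0 xT]; split.
- by move=> e e2; move/forallP/(_ e)/implyP/(_ e2)/eqP : x0.
- move=> i j k ij ik jk.
  by move/forallP/(_ i)/forallP/(_ j)/forallP/(_ k) : xT; rewrite ij ik jk.
- by apply/forallP => e; apply/implyP => /x0/eqP.
- apply/forallP => i; apply/forallP => j; apply/forallP => k.
  by apply/implyP => /and3P[]; exact: xT.
Qed.

Local Notation H := (entp R int_metrics).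

Lemma entp_perm (s : {perm 'I_n}) (A : {set E}) :
  H ((fun e : E => s @: e) @: A) = H A.
Proof.
have permM x (u : {perm 'I_n}) :
    x \in int_metrics -> [ffun e : E => x (u @: e)] \in int_metrics.
  move=> /int_metricsP[x0 xT]; apply/int_metricsP; split.
    by move=> e e2; rewrite ffunE x0// card_imset//; exact: perm_inj.
  move=> i j k ij ik jk; rewrite !ffunE !imsetU1 !imset_set1.
  by apply: xT; rewrite (inj_eq perm_inj).
have permK (u : {perm 'I_n}) :
    cancel (fun e : E => u @: e) (fun e => (u^-1)%g @: e).
  move=> e; rewrite -imset_comp -[RHS]imset_id; apply: eq_imset => i /=.
  exact: permK.
have permVK (u : {perm 'I_n}) :
    cancel (fun e : E => (u^-1)%g @: e) (fun e => u @: e).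
  by move=> e; have := permK (u^-1)%g e; rewrite invgK.
apply: entp_imset; first exact: Bijective (permK s) (permVK s).
move=> x; apply/idP/idP => [|/permM//].
have xE : [ffun e : E => [ffun e : E => x (s @: e)] ((s^-1)%g @: e)] = x.
  by apply/ffunP => e; rewrite !ffunE permVK.
by move=> /(permM _ (s^-1)%g); rewrite xE.
Qed.

Definition pairs : {set E} := [set e : E | #|e| == 2%N].

(** These coordinates are the distances from the first [k] vertices. *)
Definition pairs_meeting (k : nat) : {set E} :=
  [set e in pairs | [exists i in e, (i < k)%N]].

Lemma pairs_meetingE (k : nat) i j :
  ([set i; j] \in pairs_meeting k) = (i != j) && ((i < k) || (j < k))%N.
Proof.
rewrite !inE cards2 eqSS eqb1; congr andb.
apply/exists_inP/orP => [[l + lk]|[ik|jk]].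
- by rewrite !inE => /orP[] /eqP <-; [left|right].
- by exists i; rewrite ?inE ?eqxx.
- by exists j; rewrite ?inE ?eqxx ?orbT.
Qed.

Lemma card_pairs : #|pairs| = 'C(n, 2).
Proof.
rewrite -[in RHS](card_ord n) -cardsT -cards_draws.
by apply: eq_card => e; rewrite !inE finset.subsetT.
Qed.

Lemma pairsP e : reflect (exists i j, i != j /\ e = [set i; j]) (e \in pairs).
Proof. by rewrite inE; exact: cards2P. Qed.

Lemma card_pairs_meeting (k : nat) : (#|pairs_meeting k| <= k.+1 * n)%N.
Proof.
pose S := [set i : 'I_n | (0 <= i <= k)%N].
have subS : pairs_meeting k \subset
    [set [set p.1; p.2] | p in finset.setX S [set: 'I_n]].
  apply/fintype.subsetP => e; rewrite inE => /andP[/pairsP[i [j [ij ->]]]].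
  move=> /exists_inP[l]; rewrite !inE => /orP[] /eqP-> lk; apply/imsetP.
    by exists (i, j) => //; rewrite !inE /= ltnW.
  by exists (j, i); rewrite ?inE /= 1?ltnW//= finset.setUC.
apply: leq_trans (subset_leq_card subS) _.
apply: leq_trans (leq_imset_card _ _) _.
rewrite cardsX cardsT card_ord leq_mul2r cardsE.
by apply/orP; right; apply: leq_trans (card_ord_itv n 0 k) _; rewrite subn0.
Qed.

Lemma pairs_meeting_perm (s : {perm 'I_n}) (k : nat) :
  (forall i, (s i < k)%N = (i < k)%N) ->
  (fun e : E => s @: e) @: pairs_meeting k = pairs_meeting k.
Proof.
move=> sk.
have inj : injective (fun e : E => s @: e) by apply: imset_inj; exact: perm_inj.
apply/eqP; rewrite eqEcard card_imset// leqnn andbT.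
apply/fintype.subsetP => _ /imsetP[e + ->].
rewrite [e \in _]inE => /andP[/pairsP[i [j [ij ->]]] /exists_inP[l]].
rewrite imsetU1 imset_set1 pairs_meetingE !sk (inj_eq perm_inj) ij /=.
by rewrite !inE => /orP[] /eqP <- lk; apply/orP; [left|right].
Qed.

(** A permutation preserving the set of the first [k] vertices carries one pair to the other. *)
Lemma entp_pair_meeting (k : nat) i j i' j' :
  i != j -> i' != j' ->
  (k <= i)%N -> (k <= j)%N -> (k <= i')%N -> (k <= j')%N ->
  H ([set i; j] |: pairs_meeting k) = H ([set i'; j'] |: pairs_meeting k).
Proof.
move=> ij ij' ki kj ki' kj'.
(* The first transposition takes [i] to [i'] and [j] to [l]; the second takes [l] to [j'] and leaves
   [i'] in place. *)
pose l := tperm i i' j.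
have li' : l != i'.
  by rewrite -[X in _ != X](tpermL i i') (inj_eq perm_inj) eq_sym.
have kl : (k <= l)%N by rewrite /l; case: tpermP.
pose s := (tperm i i' * tperm l j')%g.
have sk u : (s u < k)%N = (u < k)%N.
  rewrite /s permM.
  have tk (a b v : 'I_n) : (k <= a)%N -> (k <= b)%N ->
      (tperm a b v < k)%N = (v < k)%N.
    by move=> ka kb; case: tpermP => [->|->|//]; lia.
  by rewrite !tk.
rewrite -(entp_perm s) imsetU1 pairs_meeting_perm// imsetU1 imset_set1.
by rewrite /s !permM tpermL -/l tpermL tpermD// eq_sym.
Qed.


(** * Counting the integer metrics *)

Lemma small_drop (h : nat -> R) (s : nat) : (0 < s)%N -> 0 <= h s ->
  exists2 k, (k < s)%N & h k - h k.+1 <= h 0%N / s%:R.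
Proof.
move=> s0 hs; have s0R : 0 < s%:R :> R by rewrite ltr0n.
have [/existsP[k le_k]|/existsPn gt_k] :=
    boolP [exists k : 'I_s, h k - h k.+1 <= h 0%N / s%:R].
  by exists k.
(* The drops telescope to at most [h 0], so they cannot all exceed [h 0 / s]. *)
have : \sum_(0 <= k < s) (h k - h k.+1) = h 0%N - h s.
  under eq_bigr do rewrite -opprB.
  by rewrite sumrN telescope_sumr// opprB.
have : \sum_(0 <= k < s) h 0%N / s%:R < \sum_(0 <= k < s) (h k - h k.+1).
  rewrite ltr_sum_nat// => k /andP[_ ks].
  by have := gt_k (Ordinal ks); rewrite -ltNge.
rewrite sumr_const_nat subn0 -[_ *+ s]mulr_natr divfK ?gt_eqF//; lra.
Qed.

Lemma pairs_meeting_subset (k : nat) :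
  pairs_meeting k \subset pairs_meeting k.+1.
Proof.
apply/fintype.subsetP => e; rewrite !inE => /andP[-> /exists_inP[i ie ik]].
by apply/exists_inP; exists i => //; exact: ltnW.
Qed.

(* Equivalently: given the distances from the vertices before [v], the mutual
   information of the three sides of [v, a, b] is at most twice the information
   that the distances from [v] give on the distance from [a] to [b]. *)
Lemma triangle_information (k : nat) (v a b : 'I_n) : v = k :> nat ->
  (k < a)%N -> (k < b)%N -> a != b ->
  H ([set a; b] |: pairs_meeting k) - H (pairs_meeting k) +
    2 * (H ([set a; b] |: pairs_meeting k.+1) - H (pairs_meeting k.+1)) <=
  H (pairs_meeting k :|: [set [set v; a]; [set v; b]; [set a; b]]) -
    H (pairs_meeting k).
Proof.
move=> vk ka kb ab.
set F := pairs_meeting k; set F' := pairs_meeting k.+1.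
set h := H ([set a; b] |: F) - H F.
have va : v != a by rewrite -val_eqE /= vk; lia.
have vb : v != b by rewrite -val_eqE /= vk; lia.
have FF' : F \subset F' by exact: pairs_meeting_subset.
pose B := F :|: [set [set v; a]; [set v; b]].
have BF' : B :|: F' = F'.
  apply/finset.setUidPr; rewrite finset.subUset FF' /=.
  apply/fintype.subsetP => e; rewrite finset.in_set2 => /orP[] /eqP ->.
    by rewrite pairs_meetingE va vk leqnn.
  by rewrite pairs_meetingE vb vk leqnn.
have TE : F :|: [set [set v; a]; [set v; b]; [set a; b]] =
    B :|: [set [set a; b]].
  by rewrite finset.setUA.
(* [F'] contains [B], and conditioning on more coordinates lowers entropy. *)
have le1 : H ([set a; b] |: F') - H F' <= H (B :|: [set [set a; b]]) - H B.
  have := entp_submod R (int_metrics) B [set [set a; b]] F'.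
  by rewrite BF' finset.setUCA BF'; lra.
(* Exchanging [v] and [a] fixes the side [va] and swaps [ab] with [vb], so these two have the same
   entropy given [F] and [va]. *)
have swap : H (F :|: [set [set v; a]] :|: [set [set a; b]]) = H B.
  rewrite -(entp_perm (tperm v a)) /B !imsetU !imset_set1 !imsetU1 !imset_set1.
  rewrite pairs_meeting_perm; last first.
    by move=> i; case: tpermP => [->|->|//]; rewrite vk; lia.
  rewrite tpermL tpermR (tpermD vb)//.
  by rewrite [[set a; v]]finset.setUC finset.setUA.
have le2 : H (B :|: [set [set a; b]]) - H B <= H B - H (F :|: [set [set v; a]]).
  have := entp_submod R (int_metrics) (F :|: [set [set v; a]])
    [set [set v; b]] [set [set a; b]].
  rewrite swap !finset.setUA /B !finset.setUA -/B.
  by move: (H _) (H _) (H _) => *; lra.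
have hE : H (F :|: [set [set v; a]]) - H F = h.
  rewrite finset.setUC /h; congr (_ - _).
  by apply: entp_pair_meeting; rewrite ?vk // ltnW.
rewrite TE; lra.
Qed.

(** The third vertex of the triangle is vertex number [k], where [k] has a small drop: its distances
    are what separates the conditioning in [h k] from that in [h k.+1]. *)
Lemma pair_entropy_le (s : nat) (t : R) (a b : 'I_n) :
  (0 < s)%N -> (s <= a)%N -> (s <= b)%N -> a != b -> 0 < t < 1 / 2 ->
  (0 < m)%N ->
  exists2 k, (k < s)%N &
    H ([set a; b] |: pairs_meeting k) - H (pairs_meeting k) <=
    #|int_metrics|%:R * (ln (m%:R / 2 + 1 + t * m%:R) - 2 * t * ln t +
      2 * ln m%:R ^+ 2 / (t ^+ 3 * s%:R)).
Proof.
move=> s0 sa sb ab t12 m0; have /andP[t0 t2] := t12.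
have s0R : 0 < s%:R :> R by rewrite ltr0n.
pose h (k : nat) := H ([set a; b] |: pairs_meeting k) - H (pairs_meeting k).
have hs : 0 <= h s by rewrite subr_ge0 entp_subset// finset.subsetUr.
have [k ks drop] := small_drop s0 hs; exists k => //.
have kn : (k < n)%N by have := ltn_ord a; lia.
pose v := Ordinal kn; have vk : v = k :> nat by [].
have ka : (k < a)%N by lia. have kb : (k < b)%N by lia.
have va : v != a by rewrite -val_eqE /=; lia.
have vb : v != b by rewrite -val_eqE /=; lia.
have info := triangle_information vk ka kb ab.
have triM x : x \in int_metrics ->
    [/\ (x [set v; a] <= x [set v; b] + x [set a; b] + 1)%N,
     (x [set v; b] <= x [set v; a] + x [set a; b] + 1)%N &
     (x [set a; b] <= x [set v; a] + x [set v; b] + 1)%N].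
  move=> /int_metricsP[_ xT]; split; first by apply: xT.
    by rewrite [[set a; b]]finset.setUC; apply: xT => //; rewrite eq_sym.
  rewrite [[set v; a]]finset.setUC [[set v; b]]finset.setUC.
  by apply: xT => //; rewrite eq_sym.
have := @entp_metric_triple R _ m int_metrics (pairs_meeting k)
  [set v; a] [set v; b] [set a; b] t t12.
move=> /(_ triM _ erefl) /=.
have -> : H ([set v; a] |: pairs_meeting k) = H ([set a; b] |: pairs_meeting k).
  by by apply: entp_pair_meeting; rewrite ?vk // ltnW.
have -> : H ([set v; b] |: pairs_meeting k) = H ([set a; b] |: pairs_meeting k).
  by by apply: entp_pair_meeting; rewrite ?vk // ltnW.
rewrite /= -/(h k) in info *; rewrite -/(h k.+1) in info.
set D := _ - (_ - _) => main.
have h0 : h 0%N <= #|int_metrics|%:R * ln m%:R.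
  have := @entp1_le R _ 'I_m int_metrics (pairs_meeting 0) [set a; b].
  by rewrite card_ord; apply.
have lnm : 0 <= ln m%:R :> R by rewrite ln_ge0// ler1n.
(* By [triangle_information], [D] is at most twice the drop [h k - h k.+1]. *)
have D_le : D <= 2 * (#|int_metrics|%:R * ln m%:R / s%:R).
  have : h 0%N / s%:R <= #|int_metrics|%:R * ln m%:R / s%:R.
    by rewrite ler_pM2r// invr_gt0.
  by rewrite /D; clear -drop info; lra.
have c0 : 0 <= 3 * ln m%:R / t ^+ 3.
  by rewrite divr_ge0 ?mulr_ge0 ?exprn_ge0// ltW.
have := ler_wpM2l c0 D_le.
have -> : 3 * ln m%:R / t ^+ 3 * (2 * (#|int_metrics|%:R * ln m%:R / s%:R)) =
    3 * (#|int_metrics|%:R * (2 * ln m%:R ^+ 2 / (t ^+ 3 * s%:R))).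
  by field; rewrite !gt_eqF.
clear -main; lra.
Qed.

Lemma ln_card_int_metrics (s : nat) (t : R) :
  (0 < s)%N -> (s + 2 <= n)%N -> 0 < t < 1 / 2 -> (0 < #|int_metrics|)%N ->
  ln #|int_metrics|%:R <= 'C(n, 2)%:R * (ln (m%:R / 2 + 1 + t * m%:R) -
    2 * t * ln t + 2 * ln m%:R ^+ 2 / (t ^+ 3 * s%:R)) + s%:R * n%:R.
Proof.
move=> s0 sn t12 N0; have /andP[t0 t2] := t12.
have N0R : 0 < #|int_metrics|%:R :> R by rewrite ltr0n.
have /card_gt0P[x0 _] := N0.
have m0 : (0 < m)%N by apply: leq_ltn_trans (ltn_ord (x0 finset.set0)).
(* The last two vertices: [s + 2 <= n] keeps both outside the first [s]. *)
have an : (n - 1 < n)%N by lia.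
have bn : (n - 2 < n)%N by lia.
pose a := Ordinal an; pose b := Ordinal bn.
have ab : a != b by rewrite -val_eqE /=; lia.
have sa : (s <= a)%N by rewrite /=; lia.
have sb : (s <= b)%N by rewrite /=; lia.
have [k ks hk] := pair_entropy_le s0 sa sb ab t12 m0.
set C := (X in _ * X) in hk; rewrite -/C.
pose F := pairs_meeting k; pose h := H ([set a; b] |: F) - H F.
have HF : H F <= #|F|%:R * (#|int_metrics|%:R * ln m%:R).
  have := entp_sum R int_metrics finset.set0 F.
  rewrite finset.set0U entp0 subr0 => /le_trans; apply.
  rewrite mulr_natl -sumr_const; apply: ler_sum => e _.
  have := @entp1_le R _ 'I_m int_metrics finset.set0 e.
  by rewrite card_ord entp0 subr0; apply.
have FP : F \subset pairs by apply/fintype.subsetP => e; rewrite inE => /andP[].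
(* By symmetry every pair outside [F] has the same conditional entropy [h] given [F]. *)
have Hrest : H pairs - H F <= #|pairs :\: F|%:R * h.
  have := entp_sum R int_metrics F (pairs :\: F).
  rewrite finset.setDE finset.setUIr finset.setUCr finset.setIT.
  rewrite (finset.setUidPr FP) => /le_trans; apply.
  rewrite mulr_natl -sumr_const -finset.setDE; apply: ler_sum => e.
  rewrite inE => /andP[eF /pairsP[i [j [ij eE]]]].
  move: eF; rewrite eE pairs_meetingE ij /= negb_or -!leqNgt => /andP[ki kj].
  rewrite /h (@entp_pair_meeting k i j a b)//; [exact: ltnW (leq_trans ks sa)|].
  exact: ltnW (leq_trans ks sb).
(* The other coordinates are pinned, so the pairs determine the metric. *)
have HP : H pairs = #|int_metrics|%:R * ln #|int_metrics|%:R.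
  apply: entp_inj => x y /int_metricsP[x0' _] /int_metricsP[y0' _] xy.
  have /restrP xyP : restr pairs x == restr pairs y by rewrite xy.
  apply/ffunP => e; have [eP|eP] := boolP (e \in pairs); first exact: xyP.
  by apply: val_inj; rewrite inE in eP; rewrite /= x0'// y0'.
have cardP : 'C(n, 2)%:R = #|pairs :\: F|%:R + #|F|%:R :> R.
  by rewrite -card_pairs -natrD addnC -(cardsID F pairs) (finset.setIidPr FP).
have cardF : #|F|%:R <= s%:R * n%:R :> R.
  rewrite -natrM ler_nat; apply: leq_trans (card_pairs_meeting k) _.
  by rewrite leq_mul2r ks orbT.
(* As [ln 2 <= 1], a pair in [F] costs at most 1 more than [C]; over all of [F] the excess is at
   most [s n]. *)
have C_ge : ln m%:R <= C + 1.
  have m0R : 1 <= m%:R :> R by rewrite ler1n.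
  have tm : 0 < t * m%:R by apply: mulr_gt0 => //; lra.
  have : ln (m%:R / 2) <= ln (m%:R / 2 + 1 + t * m%:R) :> R.
    by rewrite ler_ln ?posrE; lra.
  rewrite ln_div ?posrE//; last by lra.
  have ln2 : ln 2 <= 1 :> R by have := @ln_leB1 R 2; lra.
  have tln : t * ln t <= 0.
    by apply: mulr_ge0_le0; [exact: ltW | apply: ln_le0; lra].
  have : 0 <= 2 * ln m%:R ^+ 2 / (t ^+ 3 * s%:R) :> R.
    by apply: divr_ge0; rewrite mulr_ge0 ?sqr_ge0// exprn_ge0// ltW.
  rewrite /C; clear -ln2 tln; lra.
have leh : #|pairs :\: F|%:R * h <= #|pairs :\: F|%:R * (#|int_metrics|%:R * C).
  by rewrite ler_wpM2l.
have leF : #|F|%:R * (#|int_metrics|%:R * ln m%:R) <=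
    #|F|%:R * (#|int_metrics|%:R * (C + 1)) by rewrite !ler_wpM2l.
have leN := ler_wpM2l (ltW N0R) cardF.
rewrite -(ler_pM2l N0R) -HP cardP; clear -HF Hrest leh leF leN; lra.
Qed.

End IntegerMetrics.

(** * Choice of the parameters *)

Lemma ln_half_add_ge (R : realType) (y : R) : 0 <= y <= 1 / 2 ->
  ln (1 / 2) + y <= ln (1 / 2 + y).
Proof.
move=> /andP[y0 y1].
have p1 : 0 < 1 + 2 * y by lra.
have -> : 1 / 2 + y = 1 / 2 * (1 + 2 * y) by lra.
have h0 : 0 < 1 / 2 :> R by lra.
rewrite (lnM h0 p1) lerD2l.
(* [ln (1 + 2 y)] is at least [1 - (1 + 2 y)^-1], which is at least [y] because [2 y <= 1]. *)
have : 0 < (1 + 2 * y)^-1 by rewrite invr_gt0.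
move=> /ln_leB1; rewrite lnV ?posrE//.
have : (1 + 2 * y)^-1 <= 1 - y.
  rewrite -[leLHS]mul1r ler_pdivrMr//; nra.
lra.
Qed.

Lemma bin2_natr (R : realType) (n : nat) :
  'C(n, 2)%:R * 2 = n%:R * (n%:R - 1) :> R.
Proof.
have bE : ('C(n, 2) * 2 = n * n.-1)%N.
  by have := bin_ffact n 2; rewrite ffactnS ffactn1.
rewrite -natrM bE; case: n {bE} => [|n]; first by rewrite !mul0r.
by rewrite -natr1 addrK natrM natr1.
Qed.

(* In terms of [w = n^(1/120)], [s] is about [n^(4/5)], [t = n^(-1/5)] and the
   target is [n^(-1/6) = w^-20]; since [ln n <= 120 w], every error term is at
   most a constant times [z = w^-22]. *)
Lemma parameters_exist (R : realType) (w : R) (n : nat) :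
  300 <= w -> n%:R = w ^+ 120 ->
  exists s : nat, exists t : R,
    [/\ (0 < s)%N, (s + 2 <= n)%N, 0 < t < 1 / 2 &
    ln (n%:R / 2 + 1 + t * n%:R) - 2 * t * ln t +
      2 * ln n%:R ^+ 2 / (t ^+ 3 * s%:R) + s%:R * n%:R / 'C(n, 2)%:R <=
    ln n%:R + ln (1 / 2 + w ^- 20)].
Proof.
move=> w300 nw.
have w0 : 0 < w by lra.
have wX k : 0 < w ^+ k by rewrite exprn_gt0.
have wXle j k : (j <= k)%N -> w ^+ j <= w ^+ k.
  by move=> jk; rewrite ler_weXn2l//; lra.
pose s := Num.trunc (w ^+ 96); pose t := w ^- 24.
have [s_le s_gt] : s%:R <= w ^+ 96 /\ w ^+ 96 < s%:R + 1.
  have /andP[? ?] := truncn_itv (ltW (wX 96%N)).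
  by rewrite natr1.
have w96 : 300 <= w ^+ 96.
  by apply: (le_trans w300); rewrite -[leLHS]expr1 wXle.
have s1 : 1 <= s%:R :> R by lra.
have s0 : (0 < s)%N by rewrite -(ltr_nat R); lra.
have w97 : 300 * w ^+ 96 <= w ^+ 120.
  apply: (@le_trans _ _ (w ^+ 97)); last exact: wXle.
  by rewrite [w ^+ 97]exprS ler_pM2r.
have sn : (s + 2 <= n)%N by rewrite -(ler_nat R) natrD nw; lra.
have t0 : 0 < t by rewrite invr_gt0.
have t_le : t * 300 <= 1.
  rewrite mulrC ler_pdivrMr// mul1r; apply: (le_trans w300).
  by rewrite -[leLHS]expr1 wXle.
exists s, t; split => //; first by apply/andP; split=> //; lra.
have n0 : 0 < n%:R :> R by rewrite nw.
pose z := w ^- 22.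
have z0 : 0 < z by rewrite invr_gt0.
have term1 : ln (n%:R / 2 + 1 + t * n%:R) <= ln n%:R + ln (1 / 2) + 4 * z.
  have -> : n%:R / 2 + 1 + t * n%:R = n%:R * (1 / 2 * (1 + 2 * (w ^- 120 + t))).
    by rewrite nw; field; rewrite gt_eqF.
  have e0 : 0 < w ^- 120 by rewrite invr_gt0.
  have p0 : 0 < 1 + 2 * (w ^- 120 + t) by lra.
  have h0 : 0 < 1 / 2 :> R by lra.
  rewrite (lnM n0 (mulr_gt0 h0 p0)) (lnM h0 p0).
  have := ln_leB1 p0.
  have tz : t <= z by rewrite lef_pV2 ?posrE ?wXle.
  have ez : w ^- 120 <= z by rewrite lef_pV2 ?posrE ?wXle.
  lra.
have lnw : ln w <= w by have := ln_leB1 w0; lra.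
have lnw0 : 0 <= ln w by rewrite ln_ge0//; lra.
have term2 : - (2 * t * ln t) <= 48 * z.
  rewrite /t lnV ?posrE// lnXn// -mulr_natl.
  have : t * ln w <= z.
    apply: (@le_trans _ _ (t * w)); first by rewrite ler_pM2l.
    rewrite /t /z; have -> : w ^- 24 * w = w ^- 23 by field; rewrite gt_eqF.
    by rewrite lef_pV2 ?posrE ?wXle.
  rewrite /t; lra.
(* Here [t^3 s] is about [w^24] and [(ln n)^2] at most [(120 w)^2], which gives the exponent 22 of
   [z]. *)
have term3 : 2 * ln n%:R ^+ 2 / (t ^+ 3 * s%:R) <= 240 * 240 * z.
  have -> : ln n%:R = 120 * ln w by rewrite nw lnXn// -[LHS]mulr_natl.
  rewrite ler_pdivrMr ?mulr_gt0 ?exprn_gt0 ?ltr0n//.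
  apply: (@le_trans _ _ (2 * (120 * w) ^+ 2)).
    by rewrite ler_pM2l// ler_sqr ?nnegrE ?mulr_ge0// ?ler_pM2l// ltW.
  have s_ge : w ^+ 96 <= 2 * s%:R by lra.
  have c0 : 0 < 120 * 240 * z * t ^+ 3 by rewrite !mulr_gt0 ?exprn_gt0.
  have := ler_wpM2l (ltW c0) s_ge.
  have -> : 120 * 240 * z * t ^+ 3 * w ^+ 96 = 2 * (120 * w) ^+ 2.
    by rewrite /z /t; field; rewrite gt_eqF.
  lra.
have term4 : s%:R * n%:R / 'C(n, 2)%:R <= 4 * z.
  have n2 := bin2_natr R n.
  have n600 : 2 <= n%:R :> R by rewrite nw; lra.
  have P0 : 0 < 'C(n, 2)%:R :> R by rewrite ltr0n bin_gt0 -(ler_nat R).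
  rewrite ler_pdivrMr//.
  have -> : 4 * z * 'C(n, 2)%:R = n%:R * (2 * z * (n%:R - 1)).
    by rewrite (mulrCA n%:R) -n2; ring.
  rewrite mulrC ler_pM2l//; apply: (le_trans s_le).
  apply: (@le_trans _ _ (w ^+ 98)); first exact: wXle.
  have -> : w ^+ 98 = z * n%:R by rewrite nw /z; field; rewrite gt_eqF.
  have n2_ge0 : 0 <= n%:R - 2 :> R by lra.
  have := mulr_ge0 (ltW z0) n2_ge0; lra.
have wz : w ^- 20 = w ^+ 2 * z by rewrite /z; field; rewrite gt_eqF.
have : ln (1 / 2) + w ^- 20 <= ln (1 / 2 + w ^- 20).
  apply: ln_half_add_ge; rewrite invr_ge0 ltW//=.
  rewrite -div1r ler_pdivrMr//.
  have : w ^+ 1 <= w ^+ 20 by exact: wXle.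
  rewrite expr1; lra.
(* The four error constants add up to 57656, below [300^2]; hence the hypothesis [300 <= w]. *)
have : 300 * 300 * z <= w ^+ 2 * z.
  by rewrite (ler_pM2r z0) expr2 (ler_pM (ler0n R 300) (ler0n R 300) w300 w300).
rewrite wz; lra.
Qed.

(** * Covering the polytope by cubes *)

Local Open Scope classical_set_scope.

Lemma measure_le_sum_cover d (R : realType) (T : measurableType d)
    (mu : {measure set T -> \bar R}) (I : finType) (S : {set I})
    (B : I -> set T) (A : set T) :
  measurable A -> (forall i, measurable (B i)) ->
  (forall x, A x -> exists2 i, i \in S & B i x) ->
  (mu A <= \sum_(i in S) mu (B i))%E.
Proof.
move=> mA mB AB.
have sum_le (s : seq I) : measurable (\big[setU/set0]_(i <- s) B i) /\
    (mu (\big[setU/set0]_(i <- s) B i) <= \sum_(i <- s) mu (B i))%E.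
  elim: s => [|i s [mS IHs]]; first by rewrite !big_nil measure0.
  rewrite !big_cons; split; first exact: measurableU.
  apply: (le_trans (measureU2 _ _ _)) => //; exact: leeD2l.
have [mS leS] := sum_le (enum S).
rewrite -big_enum; apply: le_trans leS; apply: le_measure; rewrite ?inE//.
move=> x /AB[i iS Bix]; rewrite -bigcup_seq; exists i => //=.
by rewrite mem_enum.
Qed.

(** [a] is one less than the ceiling of [c], matching the shift by 1 in [int_metrics]. *)
Lemma nat_ceil (R : realType) (c : R) (m : nat) : 0 < c <= m%:R ->
  exists a : 'I_m, a%:R < c <= a.+1%:R.
Proof.
move=> /andP[c0 cm].
have exk : exists k, c <= k%:R by exists m.
case: (ex_minnP exk) => -[|a] ca amin; first by lra.
have am := amin _ cm; exists (Ordinal am); rewrite /= ca andbT ltNge.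
by apply/negP => /amin; rewrite ltnn.
Qed.

Section Cover.
Variables (R : realType) (n m : nat).
Hypothesis m_gt0 : (0 < m)%N.
Local Notation point := (#|{: upair n}|.-tuple (measurableTypeR R)).

Definition cell_side (x : {ffun {set 'I_n} -> 'I_m}) (i : 'I_#|{: upair n}|) :
    set R :=
  `](x (val (enum_val i)))%:R / m%:R, (x (val (enum_val i))).+1%:R / m%:R].

Definition cell (x : {ffun {set 'I_n} -> 'I_m}) : set point :=
  [set d : point | forall i, cell_side x i (tnth d i)].

Lemma measurable_cell_side x i :
  measurable (cell_side x i : set (measurableTypeR R)).
Proof. exact: measurable_itv. Qed.

Lemma measurable_cell x : measurable (cell x).
Proof. exact: (measurable_tuple_box (measurable_cell_side x)). Qed.

Lemma lebesgue_tuple_cell x :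
  lebesgue_tuple (cell x) = (m%:R ^- 'C(n, 2))%:E :> \bar R.
Proof.
have mR : 0 < m%:R :> R by rewrite ltr0n.
rewrite (lebesgue_tuple_box (measurable_cell_side x)).
rewrite (eq_bigr (fun=> (m%:R^-1)%:E)) => [|i _].
  by rewrite prodEFin prodr_const card_ord card_upair exprVn.
rewrite /cell_side lebesgue_measure_itv/= lte_fin ltr_pM2r ?invr_gt0//.
rewrite ltr_nat leqnn.
by rewrite -EFinB -mulrBl -natr1 addrAC subrr add0r mul1r.
Qed.

Lemma metric_polytope_cover (d : point) : metric_polytope R n d ->
  exists2 x, x \in int_metrics n m & cell x d.
Proof.
move=> [d01 dT].
have mR : 0 < m%:R :> R by rewrite ltr0n.
pose v (e : {set 'I_n}) : R :=
  if (insub e : option (upair n)) is Some u then tnth d (enum_rank u) else 0.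
have vE i j : dist d i j = v [set i; j]%SET by [].
have : forall e : {set 'I_n}, exists a : 'I_m,
    if #|e| == 2%N then a%:R < m%:R * v e <= a.+1%:R else a == 0%N :> nat.
  move=> e; have [/cards2P[i [j [ij ->]]]|_] := boolP (#|e| == 2%N).
    2: by exists (Ordinal m_gt0).
  apply: nat_ceil; have /andP[v0 v1] := d01 _ _ ij; rewrite vE in v0 v1.
  by rewrite mulr_gt0//= ler_piMr// ltW.
move=> /choice[f fP]; exists [ffun e => f e].
  apply/int_metricsP; split => [e e2|i j k ij ik jk].
    by have := fP e; rewrite (negbTE e2) ffunE => /eqP.
  rewrite !ffunE; have := fP [set i; j]%SET; have := fP [set i; k]%SET.
  have := fP [set j; k]%SET; rewrite !cards2 ij ik jk !eqxx.
  move=> /andP[_ jk_le] /andP[_ ik_le] /andP[ij_gt _].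
  have := dT _ _ _ ij ik jk; rewrite !vE => /(ler_wpM2l (ltW mR)).
  rewrite mulrDr => vT.
  (* The strict lower end of the cell at [ij] and the upper ends at [ik] and [jk] leave a strict
     inequality with slack 2, which over the integers is slack 1. *)
  have : (f [set i; j]%SET)%:R <
      (f [set i; k]%SET).+1%:R + (f [set j; k]%SET).+1%:R :> R.
    by apply: lt_le_trans ij_gt _; apply: le_trans vT _; exact: lerD.
  by rewrite -natrD ltr_nat; lia.
move=> i; rewrite /cell_side /= ffunE in_itv/=.
have := fP (val (enum_val i)); rewrite (valP (enum_val i)) /v valK enum_valK.
move=> /andP[lt_i le_i]; rewrite ltr_pdivrMr// ler_pdivlMr//.
by rewrite [tnth d i * _]mulrC lt_i.
Qed.

Lemma lebesgue_tuple_metric_polytope_le :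
  (lebesgue_tuple (metric_polytope R n) <=
   (#|int_metrics n m|%:R / m%:R ^+ 'C(n, 2))%:E)%E.
Proof.
have [mu muE] := @lebesgue_tuple_sigma_finite_measure R #|{: upair n}|.
rewrite -muE; apply: le_trans (measure_le_sum_cover _
  (@measurable_metric_polytope R n) measurable_cell metric_polytope_cover) _.
rewrite (eq_bigr (fun=> (m%:R ^- 'C(n, 2))%:E)) => [|x _]; last first.
  by rewrite -(lebesgue_tuple_cell x) -muE.
by rewrite sumEFin sumr_const -[X in (X%:E <= _)%E]mulr_natl.
Qed.

End Cover.

(** * The volume bound *)

Lemma root_ge_eventually (R : realType) (c : R) (k : nat) :
  0 <= c -> (0 < k)%N ->
  exists n0 : nat, forall n, (n0 < n)%N -> c <= n%:R `^ k%:R^-1.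
Proof.
move=> c0 k0; exists (Num.bound (c ^+ k)) => n n_gt.
have : c ^+ k < n%:R.
  apply: lt_trans (archi_boundP _) _; first by rewrite exprn_ge0.
  by rewrite ltr_nat.
rewrite leNgt => lt_n; apply/negP => w_lt; move: lt_n.
rewrite ltNge => /negP; apply; apply: ltW.
have -> : n%:R = (n%:R `^ k%:R^-1) ^+ k :> R.
  by rewrite -powR_mulrn ?powR_ge0// -powRrM mulVf ?powRr1// pnatr_eq0 -lt0n.
by rewrite ltr_pXn2r// nnegrE// powR_ge0.
Qed.

Unset Implicit Arguments.

Theorem theorem3p7 (R : realType) (delta : R) (delta_gt0 : 0 < delta) :
  exists n_delta : nat, forall n : nat, (n_delta < n)%N ->
    (lebesgue_tuple (metric_polytope R n) `^ ('C(n, 2)%:R^-1) <=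
     (1 / 2 + 1 / n%:R `^ (1 / 6 - delta))%R%:E)%E.
Proof.
(* The 120th root of [n] turns the powers of [n] in the estimates into integral powers of [w]. The
   threshold is uniform in [delta]. *)
have [n_delta w_ge] := @root_ge_eventually R 300 120 (ler0n _ _) isT.
exists n_delta => n n_gt.
have n0 : (0 < n)%N by exact: leq_ltn_trans n_gt.
have n0R : 0 < n%:R :> R by rewrite ltr0n.
pose w : R := n%:R `^ 120^-1.
have w300 : 300 <= w by exact: w_ge.
have w0 : 0 <= w by exact: powR_ge0.
have wX k : w ^+ k = n%:R `^ (120^-1 * k%:R) by rewrite powRrM powR_mulrn.
have nw : n%:R = w ^+ 120 by rewrite wX mulVf// powRr1// ltW.
have w1 : 1 <= n%:R :> R by rewrite ler1n.
have [s [t [s0 sn t12 err]]] := parameters_exist w300 nw.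
have P0 : 0 < 'C(n, 2)%:R :> R.
  by rewrite ltr0n bin_gt0; clear -sn; lia.
set N := #|int_metrics n n|.
have root_le : (N%:R / n%:R ^+ 'C(n, 2)) `^ 'C(n, 2)%:R^-1 <= 1 / 2 + w ^- 20.
  have rhs0 : 0 < 1 / 2 + w ^- 20 :> R.
    by rewrite addr_gt0 ?divr_gt0// invr_gt0 exprn_gt0//; lra.
  (* The zero case is settled before taking logarithms. *)
  have [N0|N0] := posnP N.
    by rewrite N0 mul0r powR0 ?invr_neq0 ?gt_eqF// ltW.
  have N0R : 0 < N%:R :> R by rewrite ltr0n.
  have q0 : 0 < N%:R / n%:R ^+ 'C(n, 2) :> R by rewrite divr_gt0 ?exprn_gt0.
  rewrite -ler_ln ?posrE ?powR_gt0// ln_powR ln_div ?posrE ?exprn_gt0//.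
  rewrite lnXn// -[ln _ *+ _]mulr_natl ler_pdivrMl//.
  have := ln_card_int_metrics s0 sn t12 N0.
  have := ler_wpM2l (ltW P0) err.
  rewrite mulrDr [_ * (_ / _)]mulrC divfK ?gt_eqF//; lra.
have vol0 : (0 <= lebesgue_tuple (metric_polytope R n))%E.
  have [mu <-] := @lebesgue_tuple_sigma_finite_measure R #|{: upair n}|.
  exact: measure_ge0.
have vol_le := @lebesgue_tuple_metric_polytope_le R n n n0.
apply: (@le_trans _ _ ((N%:R / n%:R ^+ 'C(n, 2))%:E `^ 'C(n, 2)%:R^-1)%E).
  apply: gt0_ler_poweR; last exact: vol_le.
  - by rewrite invr_ge0 ltW.
  - by rewrite in_itv/= vol0 leey.
  - by rewrite in_itv/= leey andbT (le_trans vol0).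
rewrite poweR_EFin lee_fin; apply: le_trans root_le _; rewrite lerD2l div1r.
rewrite lef_pV2 ?posrE ?powR_gt0 ?exprn_gt0//; last by lra.
(* [w^20] is [n^(1/6)], hence at least [n^(1/6 - delta)]. *)
rewrite wX ler_powR// lerBlDr.
lra.
Qed.
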